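(* Let $x\in\mathbb{C}$ with $x\neq 0$ be such that $\lambda(x)$ exists. Then $\lambda(x)=x\rho(x^{-3})$ in the following sense: if $0<|x|<1$, then $$\lim_{n\to\infty}\lambda_{2n}(x)=\lim_{n\to\infty}x\rho_{2n}(x^{-3})\quad\text{and}\quad \lim_{n\to\infty}\lambda_{2n+1}(x)=\lim_{n\to\infty}x\rho_{2n+1}(x^{-3}),$$ and if $|x|>1$, then $$\lim_{n\to\infty}\lambda_n(x)=\lim_{n\to\infty}x\rho_n(x^{-3}).$$
   Context: Write $[a_0;a_1,\dots,a_n]=a_0+\cfrac{1}{a_1+\cfrac{1}{\ddots+\cfrac{1}{a_n}}}$. For $n\ge0$ let $\lambda_n(x)=[x;x^2,x^4,\dots,x^{2^n}]$, and let $\rho_n(x)$ be given by $\rho_0(x)=1$, $\rho_n(x)=1+\dfrac{x}{\rho_{n-1}(x^2)}$ for $n\ge1$. A value $\lambda_n(x)$ or $\rho_n(x)$ is assigned only when no division by zero occurs in evaluating it at the given point. $\lambda(x)$ and $\rho(x)$ denote the limits of $\lambda_n(x)$ and $\rho_n(x)$ as $n\to\infty$. For $0<|x|<1$, ''$\lambda(x)$ exists'' is understood in the parity sense: the two limits of $\lambda_n(x)$ along even $n$ and along odd $n$ exist (they may differ); for $|x|>1$ it means that $\lim_{n\to\infty}\lambda_n(x)$ exists. *)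

(* Defs.v *)
From Stdlib Require Import Reals List.
From Coquelicot Require Import Coquelicot.

Local Open Scope C_scope.

(* Division as a partial operation: [None] stands for "no value assigned",
   whereas the library's [a / 0] is a (junk) complex number. *)
Definition pdiv (a b : C) : option C :=
  if Ceq_dec b 0 then None else Some (a / b).

Definition add_div (a b : C) (d : option C) : option C :=
  match d with
  | None => None
  | Some v => option_map (Cplus a) (pdiv b v)
  end.

(* [cfrac a0 [a1; ...; an]] is the value of the finite continued fraction
   [a0; a1, ..., an], evaluated from the innermost denominator outwards. *)
Fixpoint cfrac (a0 : C) (s : list C) : option C :=
  match s with
  | nil => Some a0
  | cons a1 s' => add_div a0 1 (cfrac a1 s')
  end.

Definition lambda (n : nat) (x : C) : option C :=
  cfrac x (map (fun k : nat => x ^ (2 ^ k)) (seq 1 n)).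

Fixpoint rho (n : nat) (x : C) : option C :=
  match n with
  | O => Some (RtoC 1)
  | S m => add_div 1 x (rho m (x ^ 2))
  end.

(* Convergence of a sequence of partially assigned values to l in C: every
   neighbourhood of l contains u n for all large n, so in particular u n is
   assigned for all large n. *)
Definition is_plim (u : nat -> option C) (l : C) : Prop :=
  filterlimi (fun n z => u n = Some z) eventually (locally l).

Definition ex_plim (u : nat -> option C) : Prop := exists l : C, is_plim u l.

(* On |x| = 1, where the parity convention does not apply, the ordinary limit
   is meant. *)
Definition lambda_exists (x : C) : Prop :=
  ((Cmod x < 1)%R ->
     ex_plim (fun n => lambda (2 * n) x) /\
     ex_plim (fun n => lambda (2 * n + 1) x)) /\
  ((1 <= Cmod x)%R -> ex_plim (fun n => lambda n x)).

Definition x_rho (n : nat) (x : C) : option C :=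
  option_map (Cmult x) (rho n (/ x ^ 3)).

(* "lim u = lim v": both limits exist in C and they coincide. *)
Definition eq_plim (u v : nat -> option C) : Prop :=
  exists l : C, is_plim u l /\ is_plim v l.

(* Main.v *)
Require Import Defs.
From Stdlib Require Import Reals List.
From Coquelicot Require Import Coquelicot.

Local Open Scope C_scope.

(** The limits agree because the approximants do: for [x <> 0] and every [n],
    [lambda n x = x_rho n x] as partial values.  This is the equivalence
    transformation that takes [x] out of the head of [x; x^2, x^4, ...] and
    divides the [k]-th denominator by its partial quotient [x^(2^k)]: the
    [k]-th partial numerator becomes
    [1 / (x^(2^(k-1)) * x^(2^k)) = (x^-3)^(2^(k-1))], which is exactly the
    [k]-th partial numerator of [rho] at [x^-3].

    Both sides satisfy a recursion in which [x] is replaced by [x^2]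
    ([lambda_S] for [lambda], the definition for [rho], as
    [(x^-3)^2 = (x^2)^-3]), so the identity follows by induction on [n].  In
    each step the denominators on the two sides differ by the nonzero factor
    [x^2], hence vanish simultaneously ([add_div_scale]), so that one side is
    defined exactly when the other is.  Existence of the limits of [lambda]
    then transfers along any subsequence of indices. *)

(** Dropping the head of [x; x^2, x^4, ...] leaves the same continued fraction
    at [x^2], since [x^(2^(k+1)) = (x^2)^(2^k)]. *)
Lemma lambda_S (n : nat) (x : C) :
  lambda (S n) x = add_div x 1 (lambda n (x ^ 2)).
Proof.
  unfold lambda; cbn [seq map cfrac].
  change (2 ^ 1)%nat with 2%nat.
  rewrite <- seq_shift, map_map.
  do 2 f_equal.
  apply map_ext; intros k.
  rewrite <- Cpow_mult_r.
  reflexivity.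
Qed.

(** One step of the equivalence transformation: the factor [x^2] in the
    denominator is absorbed into the numerator, without changing whether the
    quotient is defined. *)
Lemma add_div_scale (x : C) (d : option C) :
  x <> 0 ->
  add_div x 1 (option_map (Cmult (x ^ 2)) d) =
  option_map (Cmult x) (add_div 1 (/ x ^ 3) d).
Proof.
  intros Hx.
  destruct d as [v|]; [|reflexivity].
  assert (Hx2 : x ^ 2 <> 0) by now apply Cpow_nz.
  cbn [option_map]; unfold add_div, pdiv.
  destruct (Ceq_dec v 0) as [Hv|Hv];
    destruct (Ceq_dec (x ^ 2 * v) 0) as [Hxv|Hxv]; cbn [option_map].
  - reflexivity.
  - destruct Hxv; rewrite Hv; ring.
  - now destruct (Cmult_neq_0 _ _ Hx2 Hv).
  - f_equal; field; auto.
Qed.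

Lemma lambda_eq_x_rho (n : nat) (x : C) : x <> 0 -> lambda n x = x_rho n x.
Proof.
  revert x; induction n as [|n IH]; intros x Hx.
  - change (Some x = Some (x * 1)); f_equal; ring.
  - rewrite lambda_S, IH by now apply Cpow_nz.
    unfold x_rho; rewrite add_div_scale by exact Hx.
    cbn [rho].
    replace ((/ x ^ 3) ^ 2) with (/ (x ^ 2) ^ 3); [reflexivity|].
    simpl; field; auto.
Qed.

Lemma is_plim_ext (u v : nat -> option C) (l : C) :
  (forall n, u n = v n) -> is_plim u l -> is_plim v l.
Proof.
  intros Huv.
  apply filterlimi_ext; intros n z.
  now rewrite Huv.
Qed.

Lemma ex_plim_eq_plim (u v : nat -> option C) :
  (forall n, u n = v n) -> ex_plim u -> eq_plim u v.
Proof.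
  intros Huv [l Hl].
  exists l; split; [exact Hl|].
  exact (is_plim_ext _ _ _ Huv Hl).
Qed.

Theorem theorem1p2p10 :
  forall x : C, x <> RtoC 0 -> lambda_exists x ->
    ((0 < Cmod x < 1)%R ->
       eq_plim (fun n => lambda (2 * n) x) (fun n => x_rho (2 * n) x) /\
       eq_plim (fun n => lambda (2 * n + 1) x) (fun n => x_rho (2 * n + 1) x)) /\
    ((1 < Cmod x)%R ->
       eq_plim (fun n => lambda n x) (fun n => x_rho n x)).
Proof.
  intros x Hx [Hin Hout]; split.
  - intros [_ Hlt].
    destruct (Hin Hlt) as [Heven Hodd].
    split; apply ex_plim_eq_plim; trivial; intros n; now apply lambda_eq_x_rho.
  - intros Hgt.
    apply ex_plim_eq_plim; [intros n; now apply lambda_eq_x_rho|].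
    now apply Hout, Rlt_le.
Qed.
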